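(* There exist absolute constants $c,C>0$ such that the following holds. Let $\mathbf{G}$ be a finite abelian group with $N=|\mathbf{G}|$, let $A\subseteq\mathbf{G}$ with $|A|=\delta N$ and $\mathsf{E}(A)=|A|^3/K$, and put $L=\log|A|$. Suppose that $|A|\geqslant 8K^3$ and $\delta^3L^{28}K^{25}\leqslant c$. Then $$\rho^7(A)\,M^4(A)\,\log^7|A|\geqslant C\,\frac{|A|^{11}}{K^7}.$$
   Context: $\mathsf{E}(A)=|\{(a_1,a_2,a_3,a_4)\in A^4: a_1-a_3=a_2-a_4\}|$ is the additive energy. For $f:\mathbf{G}\to\mathbb{C}$ and $\xi$ in the dual group, $\widehat f(\xi)=\sum_g f(g)\overline{\xi(g)}$; sets are identified with indicator functions. $\rho(A)=\max_{x\neq0}|A\cap(A+x)|$ and $M(A)=\max_{\xi\neq0}|\widehat{A}(\xi)|$ over nontrivial characters $\xi$. Logarithms are natural. The paper states hypothesis and conclusion with Vinogradov symbols $\ll,\gg$, which are expressed here by the absolute constants $c,C$. *)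

(* Defs.v *)
From HB Require Import structures.
From mathcomp Require Import all_boot all_order all_algebra.
From mathcomp Require Import complex.
From mathcomp Require Import boolp classical_sets reals exp.

Set Implicit Arguments.
Unset Strict Implicit.
Unset Printing Implicit Defensive.

Import Order.TTheory GRing.Theory Num.Theory.
Local Open Scope ring_scope.
Local Open Scope complex_scope.

Section Combinatorial.
Variable G : finZmodType.
Implicit Type A : {set G}.

Definition translate A (x : G) : {set G} := ((fun a => a + x) @: A)%SET.

Definition energy A : nat :=
  #|[set q : G * G * G * G |
      let: (a1, a2, a3, a4) := q in
      [&& a1 \in A, a2 \in A, a3 \in A, a4 \in A & a1 - a3 == a2 - a4]]%SET|.

Definition rho A : nat := (\max_(x : G | x != 0%R) #|A :&: translate A x|)%N.

End Combinatorial.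

Section Fourier.
Variables (R : realType) (G : finZmodType).

(* The norm of the field [R[i]] is itself [R[i]]-valued; [normc] is the
   library's modulus with values in [R]. *)
Definition modulus (z : R[i]) : R := ComplexField.Normc.normc z.

(* Group homomorphisms from [G] to the unit circle. *)
Definition is_character (xi : G -> R[i]) : Prop :=
  (forall x, modulus (xi x) = 1) /\ {morph xi : x y / x + y >-> x * y}.

Definition trivial_character : G -> R[i] := fun=> 1.

Definition fourier (f xi : G -> R[i]) : R[i] := \sum_(g : G) f g * conjc (xi g).

Definition indicator (A : {set G}) : G -> R[i] := fun g => (g \in A)%:R.

(* The dual of a finite group is finite, so this supremum is a maximum as soon
   as [G] is nontrivial; for the trivial group it is [sup set0 = 0]. *)
Definition max_fourier (A : {set G}) : R :=
  sup [set r : R | exists xi : G -> R[i],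
        [/\ is_character xi, xi <> trivial_character &
            r = modulus (fourier (indicator A) xi)]]%classic.

End Fourier.

Arguments max_fourier R {G} A.

(* Main.v *)
Require Import Defs.
From HB Require Import structures.
From mathcomp Require Import all_boot all_order all_fingroup all_algebra.
From mathcomp Require Import all_solvable all_field all_character.
From mathcomp Require Import complex ring lra.
From mathcomp Require Import boolp classical_sets reals sequences exp.

(* Let r(x) = |A cap (A + x)|, E = E(A), and let T be the number of solutions
   of a1 + a2 + a3 + a4 = a5 + a6 + a7 + a8 in A, i.e. the sum of the squares
   of r * r. Weight a pair (x, y) of A^2 with x <> y by r(x - y). The total
   weight is E - |A|^2 >= E/2, so the closed 4-walks in A have weight at least
   (E/2)^4 / |A|^4. A closed walk is determined by its differences u, p, q and
   one base point; Cauchy-Schwarz over the differences separates the number of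
   base points, whose squares sum to the fourth moment of r, from the weights,
   whose squares contribute at most rho^4 T. Since |A| >= 8 K^3, the term
   r(0)^4 = |A|^4 of the fourth moment is dominated by rho^2 E, and therefore
   (E/2)^8 / |A|^8 <= 2 rho^6 E T. On the Fourier side
   N T <= |A|^8 + M^4 N E, and smallness of delta makes the contribution of
   the trivial character negligible. This bounds rho^6 M^4 from below; the last
   factor rho is at least |A| / (2 K). *)

Import Order.TTheory GRing.Theory Num.Theory.
Local Open Scope ring_scope.
Set Implicit Arguments.
Unset Strict Implicit.

(** * Cauchy-Schwarz and changes of summation variable *)

Lemma sum_sqr_le (R : realFieldType) (I : finType) (f g : I -> R) :
  (\sum_i f i * g i) ^+ 2 <= (\sum_i f i ^+ 2) * (\sum_i g i ^+ 2).
Proof.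
(* Lagrange's identity: this double sum of squares is twice the difference of the two sides. *)
have : 0 <= \sum_i \sum_j (f i * g j - f j * g i) ^+ 2.
  by apply: sumr_ge0 => i _; apply: sumr_ge0 => j _; rewrite sqr_ge0.
have -> : \sum_i \sum_j (f i * g j - f j * g i) ^+ 2 =
    (\sum_i f i ^+ 2) * (\sum_i g i ^+ 2) *+ 2 -
    (\sum_i f i * g i) ^+ 2 *+ 2.
  have e1 : (\sum_i f i ^+ 2) * (\sum_i g i ^+ 2) = \sum_i \sum_j f i ^+ 2 * g j ^+ 2.
    by rewrite big_distrlr.
  have e2 : (\sum_i f i ^+ 2) * (\sum_i g i ^+ 2) = \sum_i \sum_j f j ^+ 2 * g i ^+ 2.
    by rewrite e1 exchange_big.
  have e3 : (\sum_i f i * g i) ^+ 2 = \sum_i \sum_j (f i * g i) * (f j * g j).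
    by rewrite expr2 big_distrlr.
  rewrite !mulr2n {1}e1 e2 e3 -!big_split /= -sumrB; apply: eq_bigr => i _.
  rewrite -!big_split /= -sumrB; apply: eq_bigr => j _; ring.
lra.
Qed.

Lemma sum_shift (V : nmodType) (G : finZmodType) (h : G -> V) (a : G) :
  \sum_x h (x + a) = \sum_x h x.
Proof. by rewrite [RHS](reindex_inj (addIr a)). Qed.

Lemma sum_refl (V : nmodType) (G : finZmodType) (h : G -> V) (a : G) :
  \sum_x h (a - x) = \sum_x h x.
Proof. by rewrite [RHS](reindex_inj (inj_comp (addrI a) oppr_inj)). Qed.

(** * Autocorrelation, energy and closed walks *)

Section Autocorrelation.
Variables (R : realFieldType) (G : finZmodType).
Implicit Types (g b f : G -> R) (A : {set G}).

Definition ind A : G -> R := fun x => (x \in A)%:R.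

Definition autocorr g (x : G) : R := \sum_y g y * g (y - x).

Lemma ind_ge0 A x : 0 <= ind A x. Proof. exact: ler0n. Qed.

Lemma ind_sqr A x : ind A x ^+ 2 = ind A x.
Proof. by rewrite /ind; case: (x \in A); rewrite ?expr1n ?expr0n. Qed.

Lemma sum_ind A : \sum_x ind A x = #|A|%:R.
Proof.
rewrite -sum1_card natr_sum [RHS]big_mkcond; apply: eq_bigr => x _.
by rewrite /ind; case: (x \in A).
Qed.

Lemma autocorr_ind A x : autocorr (ind A) x = #|A :&: translate A x|%:R.
Proof.
rewrite -sum_ind /autocorr; apply: eq_bigr => y _.
rewrite /ind inE -natrM mulnb; congr (_ && _)%:R.
apply/idP/imsetP => [yA|[z zA ->]]; last by rewrite addrK.
by exists (y - x); rewrite ?subrK.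
Qed.

Lemma autocorr0 A : autocorr (ind A) 0 = #|A|%:R.
Proof.
rewrite -sum_ind /autocorr; apply: eq_bigr => y _.
by rewrite subr0 -expr2 ind_sqr.
Qed.

Lemma autocorr_ge0 g x : (forall y, 0 <= g y) -> 0 <= autocorr g x.
Proof. by move=> g0; apply: sumr_ge0 => y _; rewrite mulr_ge0. Qed.

Lemma autocorr_le_rho A x : x != 0 -> autocorr (ind A) x <= (rho A)%:R.
Proof. by move=> x0; rewrite autocorr_ind ler_nat /rho (bigD1 x) //= leq_maxl. Qed.

Lemma rho_le_card A : (rho A <= #|A|)%N.
Proof. by apply/bigmax_leqP => x _; rewrite subset_leq_card // subsetIl. Qed.

Lemma sum_autocorr A : \sum_x autocorr (ind A) x = #|A|%:R ^+ 2.
Proof.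
rewrite /autocorr exchange_big expr2 -sum_ind big_distrlr /=.
by apply: eq_bigr => y _; rewrite -[RHS](sum_refl _ y).
Qed.

(** Quadruples are sorted by their common difference [x]; once [a1], [a2] and [a3] are chosen, [a4]
    is forced. *)
Lemma energyE A : (energy A)%:R = \sum_x autocorr (ind A) x ^+ 2.
Proof.
rewrite /energy -sum1_card natr_sum big_mkcond /=.
transitivity (\sum_a \sum_b \sum_x
    (ind A a * ind A (a - x)) * (ind A b * ind A (b - x))).
  under [RHS]eq_bigr => a _ do under eq_bigr => b _ do rewrite -(sum_refl _ a).
  transitivity (\sum_a \sum_b \sum_c \sum_d
     (if (a, b, c, d) \in [set q : G * G * G * G |
      let: (a1, a2, a3, a4) := q in
      [&& a1 \in A, a2 \in A, a3 \in A, a4 \in A & a1 - a3 == a2 - a4]]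
      then 1 else 0 : R)).
    rewrite !pair_bigA /=; apply: eq_bigr => -[[[a b] c] d] _ //=.
  apply: eq_bigr => a _; apply: eq_bigr => b _; apply: eq_bigr => c _.
  rewrite (bigD1 (b - (a - c))) //= [X in _ + X]big1 => [|d dN].
    rewrite addr0 inE !subKr eqxx andbT /ind.
    by case: (a \in A); case: (b \in A); case: (c \in A);
       case: (_ \in A); rewrite ?(mulr0, mul0r, mulr1).
  rewrite inE; case: ifP => // /and5P[_ _ _ _ /eqP e].
  by rewrite e subKr eqxx in dN.
rewrite [RHS](eq_bigr (fun x => \sum_a \sum_b
    (ind A a * ind A (a - x)) * (ind A b * ind A (b - x)))); last first.
  by move=> x _; rewrite expr2 big_distrlr.
by rewrite [RHS]exchange_big; apply: eq_bigr => a _; rewrite [RHS]exchange_big.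
Qed.

Lemma energy_le A : (energy A)%:R <= #|A|%:R ^+ 3 :> R.
Proof.
rewrite energyE exprS -sum_autocorr mulr_sumr; apply: ler_sum => x _.
have r0 : 0 <= autocorr (ind A) x by rewrite autocorr_ge0 // => y; apply: ind_ge0.
by rewrite expr2 ler_wpM2r // autocorr_ind ler_nat subset_leq_card // subsetIl.
Qed.

(* The weight of closed walks y, y + p, y + u, y + q in [A]. *)
Lemma closed_walks_ge A b :
  (\sum_y ind A y * \sum_p ind A (y + p) * b p) ^+ 4 <=
  #|A|%:R ^+ 4 * \sum_u \sum_p \sum_q
    (b p * b q * b (p - u) * b (q - u)) *
    \sum_y ind A y * ind A (y + u) * ind A (y + p) * ind A (y + q).
Proof.
pose P x z := \sum_y ind A y * (b (x - y) * b (z - y)).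
(* Cauchy-Schwarz over the base point [y]; expanding the square leaves pairs [x], [z] joined through
   [y] with total weight [P x z]. *)
have S2 : (\sum_y ind A y * \sum_p ind A (y + p) * b p) ^+ 2 <=
    #|A|%:R * \sum_x \sum_z (ind A x * ind A z) * P x z.
  under eq_bigr => y _ do rewrite -(ind_sqr A y) expr2 -mulrA.
  apply: le_trans
    (sum_sqr_le (ind A) (fun y => ind A y * \sum_p ind A (y + p) * b p)) _.
  under eq_bigr do rewrite ind_sqr.
  rewrite sum_ind ler_wpM2l ?ler0n // le_eqVlt; apply/orP; left; apply/eqP.
  transitivity (\sum_y \sum_x \sum_z
      (ind A x * ind A z) * (ind A y * (b (x - y) * b (z - y)))).
    apply: eq_bigr => y _; rewrite exprMn ind_sqr expr2 -(sum_shift _ (- y)).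
    rewrite big_distrlr /= mulr_sumr; apply: eq_bigr => x _.
    rewrite mulr_sumr; apply: eq_bigr => z _.
    by rewrite ![y + _]addrC !subrK; ring.
  rewrite exchange_big; apply: eq_bigr => x _.
  rewrite exchange_big; apply: eq_bigr => z _.
  by rewrite mulr_sumr.
(* A second Cauchy-Schwarz, over the pairs [(x, z)], closes the walks. *)
have Q2 : (\sum_x \sum_z (ind A x * ind A z) * P x z) ^+ 2 <=
    #|A|%:R ^+ 2 * \sum_x \sum_z (ind A x * ind A z) * P x z ^+ 2.
  rewrite !pair_bigA /=.
  under eq_bigr => xz _ do
    rewrite -(ind_sqr A xz.1) -(ind_sqr A xz.2) -exprMn expr2
      -(mulrA (ind A _ * ind A _)).
  apply: le_trans (sum_sqr_le (fun xz => ind A xz.1 * ind A xz.2)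
    (fun xz => ind A xz.1 * ind A xz.2 * P xz.1 xz.2)) _.
  have -> : \sum_(xz : G * G) (ind A xz.1 * ind A xz.2) ^+ 2 = #|A|%:R ^+ 2.
    under eq_bigr do rewrite exprMn !ind_sqr.
    rewrite -(pair_bigA _ (fun x y => ind A x * ind A y)) /= -big_distrlr /=.
    by rewrite sum_ind expr2.
  rewrite ler_wpM2l ?sqr_ge0 // ler_sum // => xz _.
  by rewrite !exprMn !ind_sqr.
(* For the walk [y, x, w, z], substitute [x = y + p], [w = y + u], [z = y + q]. *)
have Qeq : \sum_x \sum_z (ind A x * ind A z) * P x z ^+ 2 =
  \sum_u \sum_p \sum_q
    (b p * b q * b (p - u) * b (q - u)) *
    \sum_y ind A y * ind A (y + u) * ind A (y + p) * ind A (y + q).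
  transitivity (\sum_x \sum_z \sum_y \sum_w ind A x * ind A z * (ind A y * ind A w) *
     (b (x - y) * b (z - y) * b (x - w) * b (z - w))).
    apply: eq_bigr => x _; apply: eq_bigr => z _.
    rewrite expr2 big_distrlr /= mulr_sumr; apply: eq_bigr => y _.
    by rewrite mulr_sumr; apply: eq_bigr => w _; ring.
  transitivity (\sum_y \sum_w \sum_x \sum_z ind A x * ind A z * (ind A y * ind A w) *
     (b (x - y) * b (z - y) * b (x - w) * b (z - w))).
    under eq_bigr => x _ do rewrite exchange_big /=.
    rewrite exchange_big /=; apply: eq_bigr => y _.
    under eq_bigr => x _ do rewrite exchange_big /=.
    by rewrite exchange_big.
  transitivity (\sum_y \sum_u \sum_p \sum_q
    (b p * b q * b (p - u) * b (q - u)) *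
    (ind A y * ind A (y + u) * ind A (y + p) * ind A (y + q))).
    apply: eq_bigr => y _; rewrite -(sum_shift _ y); apply: eq_bigr => u _.
    rewrite -(sum_shift _ y); apply: eq_bigr => p _.
    rewrite -(sum_shift _ y); apply: eq_bigr => q _.
    have e t : t + y - (u + y) = t - u by rewrite opprD addrACA subrr addr0.
    by rewrite !addrK !e ![y + _]addrC; ring.
  rewrite exchange_big /=; apply: eq_bigr => u _.
  rewrite exchange_big /=; apply: eq_bigr => p _.
  rewrite exchange_big /=; apply: eq_bigr => q _.
  by rewrite mulr_sumr.
rewrite -Qeq (_ : 4%N = (2 * 2)%N) // !exprM.
apply: le_trans
  (_ : (#|A|%:R * \sum_x \sum_z (ind A x * ind A z) * P x z) ^+ 2 <= _).
  rewrite ler_sqr ?nnegrE ?sqr_ge0 //; exact: le_trans (sqr_ge0 _) S2.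
by rewrite exprMn (expr2 (_ ^+ 2)) -mulrA ler_wpM2l ?sqr_ge0.
Qed.

(** Expanding the square gives two base points [y], [z]; the sums over [u], [p], [q] separate, and
    each equals the autocorrelation at [y - z]. Grouping the pairs by [y - z] supplies the fourth
    factor. *)
Lemma sum_fourfold_sqr A :
  \sum_u \sum_p \sum_q
    (\sum_y ind A y * ind A (y + u) * ind A (y + p) * ind A (y + q)) ^+ 2 =
  \sum_x autocorr (ind A) x ^+ 4.
Proof.
transitivity (\sum_y \sum_z ind A y * ind A z *
    (\sum_u ind A (y + u) * ind A (z + u)) ^+ 3).
  transitivity (\sum_u \sum_p \sum_q \sum_y \sum_z ind A y * ind A z *
    ((ind A (y + u) * ind A (z + u)) * ((ind A (y + p) * ind A (z + p)) *
     (ind A (y + q) * ind A (z + q))))).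
    apply: eq_bigr => u _; apply: eq_bigr => p _; apply: eq_bigr => q _.
    rewrite expr2 big_distrlr /=; apply: eq_bigr => y _; apply: eq_bigr => z _.
    ring.
  transitivity (\sum_y \sum_z \sum_u \sum_p \sum_q ind A y * ind A z *
    ((ind A (y + u) * ind A (z + u)) * ((ind A (y + p) * ind A (z + p)) *
     (ind A (y + q) * ind A (z + q))))).
    under eq_bigr => u _ do under eq_bigr => p _ do rewrite exchange_big /=.
    under eq_bigr => u _ do rewrite exchange_big /=.
    rewrite exchange_big /=; apply: eq_bigr => y _.
    under eq_bigr => u _ do under eq_bigr => p _ do rewrite exchange_big /=.
    under eq_bigr => u _ do rewrite exchange_big /=.
    by rewrite exchange_big.
  apply: eq_bigr => y _; apply: eq_bigr => z _.
  rewrite exprS expr2 big_distrl /= mulr_sumr; apply: eq_bigr => u _.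
  rewrite big_distrlr /= !mulr_sumr; apply: eq_bigr => p _.
  by rewrite !mulr_sumr.
transitivity (\sum_y \sum_z ind A y * ind A z * autocorr (ind A) (y - z) ^+ 3).
  apply: eq_bigr => y _; apply: eq_bigr => z _; congr (_ * _ ^+ 3).
  rewrite -(sum_shift _ (- y)); apply: eq_bigr => u _.
  by rewrite opprB !(addrCA _ u) subrr addr0.
transitivity (\sum_y \sum_x ind A y * ind A (y - x) * autocorr (ind A) x ^+ 3).
  apply: eq_bigr => y _; rewrite -(sum_refl _ y); apply: eq_bigr => z _.
  by rewrite subKr.
by rewrite exchange_big; apply: eq_bigr => x _; rewrite [RHS]exprS -mulr_suml.
Qed.
End Autocorrelation.

(** * The dual group as additive exponent maps *)

Section Dual.
Variable G : finZmodType.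
Variable n : nat.

(* Characters are encoded by their exponents: [f] stands for [w ^+ f x], with
   [w] a primitive [n.+1]-th root of unity and [n.+1 = #|G|]. *)
Definition dual : {set {ffun G -> 'I_n.+1}} :=
  [set f : {ffun G -> 'I_n.+1} | [forall x, forall y, f (x + y) == f x + f y]]%SET.

Lemma dualP (f : {ffun G -> 'I_n.+1}) : reflect {morph f : x y / x + y} (f \in dual).
Proof.
rewrite inE; apply: (iffP forallP) => [h x y|h x].
  exact/eqP/(forallP (h x)).
by apply/forallP => y; rewrite h.
Qed.

Lemma dual0 : 0 \in dual.
Proof. by apply/dualP => x y; rewrite !ffunE addr0. Qed.

Lemma dualB (f g : {ffun G -> 'I_n.+1}) : f \in dual -> g \in dual -> f - g \in dual.
Proof.
move=> /dualP hf /dualP hg; apply/dualP => x y.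
by rewrite !ffunE hf hg opprD addrACA.
Qed.

Lemma dual_f0 (f : {ffun G -> 'I_n.+1}) : f \in dual -> f 0 = 0.
Proof. by move=> /dualP h; apply: (addrI (f 0)); rewrite -h !addr0. Qed.

(* The values of a linear character of [G] are powers of a primitive [|G|]-th
   root of unity; the exponents form the required additive map. *)
Lemma dual_separates (x : G) : #|G| = n.+1 -> x != 0 ->
  exists2 f, f \in dual & f x != 0.
Proof.
move=> cG x0; pose D := [set: G]%G.
have lin (i : Iirr D) : 'chi_i \is a linear_char.
  by move: i; apply/char_abelianP; apply: FinRing.zmod_abelian.
(* The kernels of the irreducible characters intersect trivially. *)
have [i xi] : exists i : Iirr D, x \notin cfker 'chi_i.
  apply/existsP; apply: contraNT x0 => /existsPn all_ker.
  have : x \in \bigcap_i cfker 'chi[D]_i.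
    by apply/bigcapP => i _; apply/negPn/all_ker.
  by rewrite TI_cfker_irr inE.
have [z prz] := C_prim_root_exists (ltn0Sn n).
have pw y : 'chi_i y ^+ n.+1 = 1.
  have : (#[y]%g %| n.+1)%N by rewrite -cG -cardsT order_dvdG // inE.
  move=> /dvdnP[k ->]; rewrite mulnC exprM lin_char_unity_root ?expr1n // inE.
pose f := [ffun y => sval (prim_rootP prz (pw y))].
have fE y : 'chi_i y = z ^+ f y by rewrite ffunE; case: prim_rootP.
exists f.
  apply/dualP => u v; apply/eqP; rewrite -val_eqE /=.
  rewrite -[X in X == _](modn_small (ltn_ord _)) -(eq_prim_root_expr prz) exprD -!fE.
  by rewrite -lin_charM // inE.
apply: contra xi => /eqP fx; rewrite cfkerEirr inE fE fx expr0.
by rewrite lin_char1.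
Qed.
End Dual.

(** [X^n - 1] splits into [n] distinct factors, and a list of [n] distinct [n]-th roots of unity
    contains a primitive one. Applied to [R[i]], this turns exponent maps, obtained from
    algebraic-valued characters, into characters over [R[i]]. *)
Lemma closed_prim_root_exists (F : numClosedFieldType) n :
  (0 < n)%N -> exists z : F, n.-primitive_root z.
Proof.
move=> n_gt0; pose p : {poly F} := 'X^n - 1.
have [r Dp] := closed_field_poly_normal p.
rewrite (monicP _) ?monicXnsubC // scale1r in Dp.
have rn1 : all n.-unity_root r by apply/allP => z; rewrite -root_prod_XsubC -Dp.
have sz_r : (n < (size r).+1)%N.
  by rewrite -(size_prod_XsubC r id) -Dp size_XnsubC.
have [|z] := hasP (has_prim_root n_gt0 rn1 _ sz_r); last by exists z.
by rewrite -separable_prod_XsubC -Dp separable_Xn_sub_1 // pnatr_eq0 -lt0n.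
Qed.

(** * Orthogonality of characters and Parseval's identity *)

Section Fourier.
Variables (R : realType) (G : finZmodType) (n : nat).
Hypothesis cardG : #|G| = n.+1.
Variable w : R[i].
Hypothesis prim_w : n.+1.-primitive_root w.
Implicit Types (f : {ffun G -> 'I_n.+1}) (g : G -> R).

Definition chi f : G -> R[i] := fun x => w ^+ f x.

Lemma expr_ordD (a b : 'I_n.+1) : w ^+ (a + b)%R = w ^+ a * w ^+ b.
Proof. by rewrite /= (prim_expr_mod prim_w) exprD. Qed.

Lemma modulusE (z : R[i]) : (modulus z)%:C%C = `|z|.
Proof. by case: z. Qed.

Lemma modulus_ge0 (z : R[i]) : 0 <= modulus z.
Proof. by case: z => a b; apply: sqrtr_ge0. Qed.

Lemma modulus_pw k : modulus (w ^+ k) = 1.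
Proof.
have h : modulus w = 1.
  apply/eqP; rewrite -(pexpr_eq1 (ltn0Sn n)) ?modulus_ge0 //.
  apply/eqP/complexI; rewrite rmorphXn /= modulusE.
  by rewrite -normrX (prim_expr_order prim_w) normr1.
by apply: complexI; rewrite modulusE normrX -modulusE h expr1n.
Qed.

Lemma chi_is_character f : f \in dual G n -> is_character (chi f).
Proof.
move=> /dualP h; split=> [x|x y]; first exact: modulus_pw.
by rewrite /chi h expr_ordD.
Qed.

(** Ensures that nonzero exponent maps give characters counted by [max_fourier]. *)
Lemma chi_inj f : chi f = @trivial_character R G -> f = 0.
Proof.
move=> h; apply/ffunP => x; rewrite ffunE; apply/val_inj/eqP.
have /eqP : w ^+ f x = w ^+ 0 by rewrite expr0 -[RHS]/(@trivial_character R G x) -h.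
by rewrite (eq_prim_root_expr prim_w) !modn_small.
Qed.

Lemma conj_chiM f x y : f \in dual G n ->
  conjc (chi f x) * chi f y = w ^+ f (y - x).
Proof.
move=> fD; have nz : chi f x != 0
  by rewrite -normr_eq0 -modulusE modulus_pw oner_eq0.
apply: (mulfI nz); rewrite mulrA -sqr_normc -modulusE modulus_pw expr1n mul1r.
by rewrite /chi -expr_ordD -(dualP _ fD) addrC subrK.
Qed.

(** Translating the dual by some [h] with [h x != 0] permutes the terms, yet multiplies the sum by
    [w ^+ h x], which is not 1. *)
Lemma sum_dual (x : G) : x != 0 -> \sum_(f in dual G n) w ^+ f x = 0.
Proof.
move=> x0; have [h hD hx] := dual_separates cardG x0.
apply/eqP; set S := \sum_(f in _) _.
have hS : w ^+ h x * S = S.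
  rewrite mulr_sumr [RHS](reindex_inj (addrI h)) /=; apply: eq_big => [f|f _].
    apply/idP/idP => [fD|hfD].
      by rewrite -[f]opprK dualB // -sub0r dualB ?dual0.
    by rewrite -(addKr h f) addrC dualB.
  by rewrite ffunE expr_ordD.
have : (w ^+ h x - 1) * S = 0 by rewrite mulrBl hS mul1r subrr.
move=> /eqP; rewrite mulf_eq0 => /orP[|//].
rewrite subr_eq0 -(expr0 w) (eq_prim_root_expr prim_w) !modn_small // => h0.
by case/negP: hx.
Qed.

Lemma sum_chi f : f \in dual G n -> f != 0 -> \sum_x chi f x = 0.
Proof.
move=> fD f0; have /existsP[y fy] : [exists y, f y != 0].
  apply: contraNT f0; rewrite negb_exists => /forallP h.
  by apply/eqP/ffunP => x; rewrite ffunE; apply/eqP/negPn/h.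
set S := \sum_x _; apply/eqP.
have hS : chi f y * S = S.
  rewrite mulr_sumr [RHS](reindex_inj (addrI y)) /=; apply: eq_bigr => x _.
  by rewrite /chi (dualP _ fD) expr_ordD.
have : (chi f y - 1) * S = 0 by rewrite mulrBl hS mul1r subrr.
move=> /eqP; rewrite mulf_eq0 => /orP[|//].
rewrite subr_eq0 /chi -(expr0 w) (eq_prim_root_expr prim_w) !modn_small // => h0.
by case/negP: fy.
Qed.

Lemma sum_dual0 : \sum_(f in dual G n) w ^+ f 0 = #|dual G n|%:R.
Proof.
rewrite -sum1_card natr_sum; apply: eq_bigr => f fD.
by rewrite dual_f0.
Qed.

(** Sum [w ^+ f x] over all [x] and [f]: by orthogonality only [x = 0] survives in one order and
    only [f = 0] in the other. *)
Lemma card_dual : #|dual G n| = #|G|.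
Proof.
apply/eqP; rewrite -(eqr_nat R[i]) -sum_dual0; apply/eqP.
transitivity (\sum_x \sum_(f in dual G n) w ^+ f x).
  by rewrite (bigD1 0) //= [X in _ + X]big1 ?addr0 // => x /sum_dual.
rewrite exchange_big /= (bigD1 (0 : {ffun G -> 'I_n.+1})) ?dual0 //=.
rewrite [X in _ + X]big1 ?addr0.
  by rewrite -sum1_card natr_sum; apply: eq_bigr => x _; rewrite ffunE.
by move=> f /andP[fD f0]; rewrite -[RHS](sum_chi fD f0).
Qed.

Lemma parseval g :
  \sum_(f in dual G n) modulus (fourier (fun x => (g x)%:C%C) (chi f)) ^+ 2 =
  #|G|%:R * \sum_x g x ^+ 2.
Proof.
apply: complexI; rewrite rmorph_sum rmorphM rmorph_nat rmorph_sum /=.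
transitivity (\sum_(f in dual G n) \sum_x \sum_y (g x * g y)%:C%C * w ^+ f (y - x)).
  apply: eq_bigr => f fD; rewrite rmorphXn /= modulusE sqr_normc.
  rewrite rmorph_sum big_distrlr /=; apply: eq_bigr => x _; apply: eq_bigr => y _.
  rewrite [in LHS]rmorphM /= conjcK oppr0 -[(g y +i* 0)%C]/((g y)%:C%C).
  rewrite [in RHS]rmorphM -conj_chiM //.
  by rewrite mulrACA.
rewrite exchange_big mulr_sumr; apply: eq_bigr => x _.
rewrite exchange_big (bigD1 x) //= [X in _ + X]big1 ?addr0.
  by rewrite -mulr_sumr subrr sum_dual0 card_dual mulrC expr2.
by move=> y yx; rewrite -mulr_sumr sum_dual ?mulr0 // subr_eq0.
Qed.

(** The transform of [autocorr g] is the transform of [g] times its conjugate. The form with moduli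
    can be iterated and fed to [parseval]. *)
Lemma fourier_autocorr f g : f \in dual G n ->
  modulus (fourier (fun x => (autocorr g x)%:C%C) (chi f)) =
  modulus (fourier (fun x => (g x)%:C%C) (chi f)) ^+ 2.
Proof.
move=> fD; apply: complexI; rewrite rmorphXn /= !modulusE sqr_normc.
set F := fourier _ _; suff -> : F =
    conjc (fourier (fun x => (g x)%:C%C) (chi f)) *
    fourier (fun x => (g x)%:C%C) (chi f).
  by rewrite mulrC -sqr_normc normrX normr_id.
rewrite {}/F rmorph_sum big_distrlr /=.
transitivity (\sum_x \sum_y (g y * g (y - x))%:C%C * w ^+ f (- x)).
  apply: eq_bigr => x _; rewrite rmorph_sum mulr_suml; apply: eq_bigr => y _.
  congr (_ * _); rewrite -sub0r -conj_chiM // /chi dual_f0 //= expr0 mulr1.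
  by [].
rewrite exchange_big [RHS]exchange_big /=; apply: eq_bigr => y _.
rewrite -(sum_refl _ y); apply: eq_bigr => z _.
rewrite subKr opprB.
rewrite [in RHS]rmorphM /= conjcK oppr0 -[(g z +i* 0)%C]/((g z)%:C%C).
by rewrite rmorphM -conj_chiM // /=; ring.
Qed.
End Fourier.

(** * Physical-side and Fourier-side moment inequalities *)

Section Moment.
Variables (R : realType) (G : finZmodType).
Implicit Type A : {set G}.

Lemma fourth_moment_le A :
  \sum_x autocorr (ind R A) x ^+ 4 <=
  #|A|%:R ^+ 4 + (rho A)%:R ^+ 2 * (energy A)%:R.
Proof.
rewrite (bigD1 0) //= autocorr0 lerD2l energyE mulr_sumr [leRHS](bigD1 0) //=.
apply: ler_wpDl; first by rewrite mulr_ge0 ?sqr_ge0.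
apply: ler_sum => x x0; rewrite (exprD _ 2 2) ler_wpM2r ?sqr_ge0 //.
rewrite ler_sqr ?nnegrE ?ler0n ?autocorr_le_rho //.
by apply: autocorr_ge0 => y; apply: ind_ge0.
Qed.

(** Away from 0 one factor of the squared autocorrelation is at most [rho A]. This later bounds
    [rho A] from below. *)
Lemma energy_sub_le A :
  (energy A)%:R - #|A|%:R ^+ 2 <= (rho A)%:R * #|A|%:R ^+ 2 :> R.
Proof.
rewrite energyE (bigD1 0) //= autocorr0 addrAC subrr add0r.
rewrite -[in leRHS]sum_autocorr mulr_sumr [leRHS](bigD1 0) //=.
have r0 x : 0 <= autocorr (ind R A) x.
  by apply: autocorr_ge0 => y; apply: ind_ge0.
apply: ler_wpDl; first by rewrite mulr_ge0 ?ler0n.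
by apply: ler_sum => x x0; rewrite expr2 ler_wpM2r // autocorr_le_rho.
Qed.

Lemma eighth_moment_ge A : #|A|%:R ^+ 2 <= (energy A)%:R :> R ->
  ((energy A)%:R - #|A|%:R ^+ 2) ^+ 8 <=
  #|A|%:R ^+ 8 * ((#|A|%:R ^+ 4 + (rho A)%:R ^+ 2 * (energy A)%:R) *
    ((rho A)%:R ^+ 4 * \sum_u autocorr (autocorr (ind R A)) u ^+ 2)) :> R.
Proof.
(* [b] drops the value [r 0 = #|A|], which [rho A] need not dominate; this makes [b2] hold
   everywhere. *)
move=> Ege; pose r := autocorr (ind R A); pose b x := if x == 0 then 0 else r x.
have r0 x : 0 <= r x by rewrite /r autocorr_ge0 // => y; apply: ind_ge0.
have b0 x : 0 <= b x by rewrite /b; case: eqP.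
have b2 x : b x ^+ 2 <= (rho A)%:R * r x.
  rewrite /b; case: eqVneq => [->|x0]; first by rewrite expr0n mulr_ge0 ?ler0n.
  by rewrite expr2 ler_wpM2r // autocorr_le_rho.
have := closed_walks_ge A b; set S := \sum_y _ * _; set Q := \sum_u _.
have -> : S = (energy A)%:R - #|A|%:R ^+ 2.
  transitivity (\sum_p b p * r p).
    rewrite /S; under eq_bigr => y _ do rewrite mulr_sumr.
    rewrite exchange_big; apply: eq_bigr => p _ /=.
    rewrite /r /autocorr mulr_sumr -(sum_shift _ (- p)); apply: eq_bigr => y _.
    by rewrite subrK; ring.
  rewrite energyE (bigD1 0) //= [in RHS](bigD1 0) //= autocorr0 /b eqxx mul0r add0r.
  rewrite [RHS]addrAC subrr add0r; apply: eq_bigr => x x0.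
  by rewrite (negPf x0) expr2.
move=> SQ; rewrite (_ : 8 = 4 * 2)%N // !exprM.
apply: le_trans (_ : (#|A|%:R ^+ 4 * Q) ^+ 2 <= _).
  rewrite ler_sqr ?nnegrE // ?exprn_ge0 ?subr_ge0 //.
  by apply: le_trans SQ; rewrite exprn_ge0 ?subr_ge0.
rewrite exprMn ler_wpM2l ?sqr_ge0 //.
pose W u p q := b p * b q * b (p - u) * b (q - u).
pose C u p q :=
  \sum_y ind R A y * ind R A (y + u) * ind R A (y + p) * ind R A (y + q).
(* Cauchy-Schwarz over the triples [(u, p, q)] separates the weights [W] from the base-point counts
   [C]. *)
have QW : Q = \sum_(t : G * G * G) W t.1.1 t.1.2 t.2 * C t.1.1 t.1.2 t.2.
  by rewrite /Q !pair_bigA.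
rewrite {}QW; apply: le_trans (sum_sqr_le (fun t => W t.1.1 t.1.2 t.2) _) _.
rewrite mulrC; apply: ler_pM.
- by apply: sumr_ge0 => t _; rewrite sqr_ge0.
- by apply: sumr_ge0 => t _; rewrite sqr_ge0.
- apply: le_trans (fourth_moment_le A); rewrite -sum_fourfold_sqr.
  by rewrite !pair_bigA.
rewrite -(pair_bigA _ (fun t q => W t.1 t.2 q ^+ 2)) /=.
rewrite -(pair_bigA _ (fun u p => \sum_q W u p q ^+ 2)) /= mulr_sumr.
(* For fixed [u], the sum over [p] and [q] of [r p * r (p - u) * (r q * r (q - u))] is the square of
   [autocorr r u]; [b2] costs one [rho A] for each of the four squared weights. *)
apply: ler_sum => u _; rewrite expr2 big_distrlr /= mulr_sumr.
apply: ler_sum => p _; rewrite mulr_sumr; apply: ler_sum => q _.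
have -> : (rho A)%:R ^+ 4 * (r p * r (p - u) * (r q * r (q - u))) =
    ((rho A)%:R * r p) * ((rho A)%:R * r q) *
    ((rho A)%:R * r (p - u)) * ((rho A)%:R * r (q - u)) by ring.
rewrite /W !exprMn.
by apply: ler_pM; [| |apply: ler_pM; [| |apply: ler_pM|]|];
  rewrite ?mulr_ge0 ?sqr_ge0.
Qed.

Lemma indicatorE A : @indicator R G A = fun x => (ind R A x)%:C%C.
Proof. by apply/funext => x; rewrite /indicator /ind rmorph_nat. Qed.

(** Serves twice: it bounds the trivial character's term, and it makes the set under the supremum in
    [max_fourier] bounded above. *)
Lemma fourier_indicator_le A xi : is_character xi ->
  modulus (fourier (@indicator R G A) xi) <= #|A|%:R.
Proof.
move=> [xi1 _]; rewrite -lecR modulusE rmorph_nat -sum1_card natr_sum.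
apply: le_trans (ler_norm_sum _ _ _) _; rewrite [leRHS]big_mkcond /=.
apply: ler_sum => x _; rewrite normrM normcJ -[`|xi x|]modulusE xi1 mulr1.
by rewrite /indicator; case: (x \in A); rewrite ?normr1 ?normr0.
Qed.

Lemma fourier_le_max A xi : is_character xi -> xi <> @trivial_character R G ->
  modulus (fourier (@indicator R G A) xi) <= max_fourier R A.
Proof.
move=> h1 h2; apply: ub_le_sup; last by exists xi.
by exists #|A|%:R => _ [xi' [h _ ->]]; apply: fourier_indicator_le.
Qed.

(** By Parseval the left side is the eighth moment of the transform of [A], and [#|G| * energy A] is
    its fourth moment. Four of the eight factors are bounded by the maximum at each nontrivial
    character. *)
Lemma eighth_moment_le A :
  #|G|%:R * \sum_u autocorr (autocorr (ind R A)) u ^+ 2 <=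
  #|A|%:R ^+ 8 + max_fourier R A ^+ 4 * (#|G|%:R * (energy A)%:R).
Proof.
have [n cG] : exists n, #|G| = n.+1.
  by exists #|G|.-1; rewrite prednK //; apply/card_gt0P; exists 0.
have [w prw] := @closed_prim_root_exists (R[i] : numClosedFieldType) n.+1 isT.
pose F (f : {ffun G -> 'I_n.+1}) := modulus (fourier (indicator R A) (chi w f)).
have F0 f : 0 <= F f by apply: modulus_ge0.
rewrite energyE -!(parseval cG prw).
have F2 f : f \in dual G n ->
    modulus (fourier (fun x => (autocorr (ind R A) x)%:C%C) (chi w f)) =
    F f ^+ 2.
  by move=> fD; rewrite (fourier_autocorr prw) // /F indicatorE.
under eq_bigr => f fD do rewrite (fourier_autocorr prw) // F2 // -!exprM.
under [in leRHS]eq_bigr => f fD do rewrite F2 // -!exprM.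
rewrite (bigD1 (0 : {ffun G -> 'I_n.+1})) ?dual0 //=; apply: lerD.
  rewrite lerXn2r ?nnegrE ?ler0n // fourier_indicator_le //.
  by apply: chi_is_character; rewrite ?dual0.
rewrite mulr_sumr [leRHS](bigD1 (0 : {ffun G -> 'I_n.+1})) ?dual0 //=; apply: ler_wpDl.
  by rewrite mulr_ge0 ?exprn_even_ge0.
apply: ler_sum => f /andP[fD f0]; rewrite (exprD _ 4 4) ler_wpM2r ?exprn_ge0 //.
have Fle : F f <= max_fourier R A.
  apply: fourier_le_max; first exact: chi_is_character.
  by move=> /(chi_inj prw); apply/eqP.
by rewrite lerXn2r ?nnegrE // (le_trans _ Fle).
Qed.
End Moment.

(** * Logarithm bound and numerical assembly *)

Lemma ln_ge1 (R : realType) (x : R) : 8 <= x -> 1 <= ln x.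
Proof.
move=> x8; rewrite -[leLHS]expRK ler_ln ?posrE ?expR_gt0 //; last lra.
(* From [expR (- 1/2) >= 1/2] follows [expR 1 <= 4]. *)
apply: le_trans x8; have := expR_ge1Dx (- 2^-1 : R).
have : expR (1 : R) * expR (- 2^-1) * expR (- 2^-1) = 1.
  by rewrite -!expRD (_ : 1 + _ + _ = 0) ?expR0 //; lra.
have := expR_gt0 (1 : R); nra.
Qed.

Theorem theorem5 (R : realType) :
  exists c C : R, 0 < c /\ 0 < C /\
    forall (G : finZmodType) (A : {set G}) (delta K L : R),
      #|A|%:R = delta * #|G|%:R ->
      (energy A)%:R = #|A|%:R ^+ 3 / K ->
      L = ln #|A|%:R ->
      8 * K ^+ 3 <= #|A|%:R ->
      delta ^+ 3 * L ^+ 28 * K ^+ 25 <= c ->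
      C * (#|A|%:R ^+ 11 / K ^+ 7) <=
        (rho A)%:R ^+ 7 * max_fourier R A ^+ 4 * ln #|A|%:R ^+ 7.
Proof.
(* [2 ^- 30] is the cube of the bound wanted for [delta * K ^+ 7]; [2 ^- 11] combines [2 ^- 10] from
   [main_term] with [1/2] from [p_ge]. *)
exists (2 ^- 30), (2 ^- 11); do 2![split; first by rewrite invr_gt0 exprn_gt0].
move=> G A delta K L Adelta EK -> AK small.
(* For empty [A] both sides vanish, since [ln 0] is 0 by convention. *)
have [A0|A_gt0] := posnP #|A|.
  by rewrite A0 expr0n mul0r mulr0 ln0 // expr0n mulr0.
have N_gt0 : 0 < #|G|%:R :> R.
  by rewrite ltr0n (leq_trans A_gt0) // max_card.
have := eighth_moment_le R A; have := @eighth_moment_ge R G A.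
have := energy_sub_le R A; have := energy_le R A.
have : (rho A)%:R <= #|A|%:R :> R by rewrite ler_nat rho_le_card.
have : 0 <= (rho A)%:R :> R by rewrite ler0n.
have : #|A|%:R ^+ 2 <= (energy A)%:R :> R.
  rewrite energyE (bigD1 0) //= autocorr0 lerDl sumr_ge0 // => x _.
  exact: sqr_ge0.
set T := \sum_u _; have : 0 <= T by apply: sumr_ge0 => u _; rewrite sqr_ge0.
move: EK AK Adelta small; set M := max_fourier R A.
have : 0 < #|A|%:R :> R by rewrite ltr0n.
move: N_gt0; move: #|G|%:R #|A|%:R (energy A)%:R (rho A)%:R T M.
move=> {A A_gt0 G} N a e p T M N_gt0 a_gt0 eK aK adelta small.
move=> T_ge0 e_ge p_ge0 pa e_le pX.
move=> /(_ e_ge) T_lower T_upper.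
have e_gt0 : 0 < e by apply: lt_le_trans e_ge; rewrite exprn_gt0.
have K_gt0 : 0 < K.
  by move: e_gt0; rewrite eK pmulr_rgt0 ?exprn_gt0 // invr_gt0.
have K_ge1 : 1 <= K.
  move: e_le; rewrite eK ler_pdivrMr // ler_pMr ?exprn_gt0 //.
have L_ge1 : 1 <= ln a.
  by apply: ln_ge1; apply: le_trans aK; rewrite ler_peMr // exprn_ege1.
have delta_ge0 : 0 <= delta.
  by rewrite -(pmulr_lge0 _ N_gt0) -adelta ltW.
(* Compare cubes: [K] and [ln a] are at least 1, so [delta ^+ 3 * K ^+ 21] is at most the quantity
   in [small]. *)
have delta_small : delta * K ^+ 7 <= 2 ^- 10.
  rewrite -(@ler_pXn2r _ 3) ?nnegrE ?invr_ge0 ?mulr_ge0 ?exprn_ge0 ?(ltW K_gt0) //.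
  rewrite exprVn -!exprM; apply: le_trans small.
  rewrite exprMn -exprM -mulrA ler_wpM2l ?exprn_ge0 //.
  apply: le_trans (_ : 1 * K ^+ 25 <= _).
    by rewrite mul1r ler_weXn2l.
  by rewrite ler_wpM2r ?exprn_ge0 ?(ltW K_gt0) // exprn_ege1.
(* With [a = X * K] and [e = X ^+ 3 * K ^+ 2], the remaining bounds are polynomial in [X] and
   [K]. *)
pose X := a / K.
have aE : a = X * K by rewrite /X divfK // gt_eqF.
have eE : e = X ^+ 3 * K ^+ 2.
  by rewrite eK aE; field; rewrite gt_eqF.
have X_gt0 : 0 < X by rewrite divr_gt0.
have X_ge : 8 * K ^+ 2 <= X.
  by rewrite /X ler_pdivlMr // -mulrA -exprSr.
have K2_ge1 : 1 <= K ^+ 2 by rewrite exprn_ege1.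
clearbody X.
(* Here [e - a ^+ 2 = (X - 1) * a ^+ 2], and [X >= 8]. *)
have p_ge : X / 2 <= p.
  have : X - 1 <= p.
    rewrite -(ler_pM2r (exprn_gt0 2 a_gt0)); apply: le_trans pX.
    rewrite eE aE le_eqVlt; apply/orP; left; apply/eqP; ring.
  lra.
have p_gt0 : 0 < p by apply: lt_le_trans p_ge; rewrite divr_gt0.
(* The hypothesis [8 * K ^+ 3 <= a] enters as [K ^+ 2 <= X / 4]. *)
have a4_le : a ^+ 4 <= p ^+ 2 * e.
  apply: le_trans (_ : (X / 2) ^+ 2 * e <= _).
    rewrite eE aE.
    have -> : (X / 2) ^+ 2 * (X ^+ 3 * K ^+ 2) = (X ^+ 4 * K ^+ 2) * (X / 4) by field.
    have -> : (X * K) ^+ 4 = (X ^+ 4 * K ^+ 2) * K ^+ 2 by ring.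
    rewrite ler_wpM2l ?mulr_ge0 ?exprn_ge0 ?ltW //; lra.
  by rewrite ler_wpM2r ?(ltW e_gt0) // ler_sqr ?nnegrE ?divr_ge0 ?(ltW X_gt0).
have e_half : e / 2 <= e - a ^+ 2.
  rewrite eE aE; have : 0 <= X ^+ 2 * K ^+ 2 * (X - 2).
    by rewrite !mulr_ge0 ?exprn_ge0 ?ltW //; lra.
  lra.
have T_lower' : X ^+ 13 * K ^+ 6 <= 2 ^+ 9 * p ^+ 6 * T.
  (* The factor common to [(e / 2) ^+ 8] and [2 * a ^+ 8 * e], up to powers of 2. *)
  have c_gt0 : 0 < X ^+ 11 * K ^+ 10 / 2 ^+ 8
    by rewrite ?(mulr_gt0, invr_gt0, exprn_gt0).
  rewrite -(ler_pM2l c_gt0).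
  have -> : X ^+ 11 * K ^+ 10 / 2 ^+ 8 * (X ^+ 13 * K ^+ 6) = (e / 2) ^+ 8.
    by rewrite eE; field.
  have -> : X ^+ 11 * K ^+ 10 / 2 ^+ 8 * (2 ^+ 9 * p ^+ 6 * T) =
      a ^+ 8 * ((p ^+ 2 * e + p ^+ 2 * e) * (p ^+ 4 * T)).
    by rewrite eE aE; field.
  apply: le_trans (_ : (e - a ^+ 2) ^+ 8 <= _).
    by rewrite lerXn2r ?nnegrE ?subr_ge0 ?divr_ge0 ?(ltW e_gt0).
  apply: le_trans T_lower _; rewrite ler_wpM2l ?exprn_ge0 ?(ltW a_gt0) //.
  by rewrite ler_wpM2r ?lerD2r // mulr_ge0 ?exprn_ge0.
have T_upper' : T <= delta * a ^+ 7 + M ^+ 4 * e.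
  rewrite -(ler_pM2l N_gt0); apply: le_trans T_upper _.
  rewrite le_eqVlt; apply/orP; left; apply/eqP.
  by rewrite exprS {1}adelta; ring.
have main_term : X ^+ 10 * K ^+ 4 <= 2 ^+ 10 * (p ^+ 6 * M ^+ 4).
  have c_gt0 : 0 < X ^+ 3 * K ^+ 2 by rewrite mulr_gt0 ?exprn_gt0.
  rewrite -(ler_pM2l c_gt0).
  (* By [p <= a] and [delta_small], the trivial character accounts for at most half of the lower
     bound in [T_lower']; absorbing it turns [2 ^+ 9] into [2 ^+ 10]. *)
  have h1 : p ^+ 6 * (delta * a ^+ 7) <= X ^+ 13 * K ^+ 6 / 2 ^+ 10.
    apply: le_trans (_ : a ^+ 6 * (delta * a ^+ 7) <= _).
      rewrite ler_wpM2r ?mulr_ge0 ?exprn_ge0 ?(ltW a_gt0) //.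
      by rewrite lerXn2r ?nnegrE ?(ltW a_gt0).
    have -> : a ^+ 6 * (delta * a ^+ 7) = X ^+ 13 * K ^+ 6 * (delta * K ^+ 7).
      by rewrite aE; ring.
    by rewrite ler_wpM2l // mulr_ge0 ?exprn_ge0 ?ltW.
  have h2 : p ^+ 6 * T <= p ^+ 6 * (delta * a ^+ 7) + p ^+ 6 * (M ^+ 4 * e).
    by rewrite -mulrDr ler_wpM2l ?exprn_ge0.
  have -> : X ^+ 3 * K ^+ 2 * (X ^+ 10 * K ^+ 4) = X ^+ 13 * K ^+ 6 by ring.
  have -> : X ^+ 3 * K ^+ 2 * (2 ^+ 10 * (p ^+ 6 * M ^+ 4)) =
     2 ^+ 10 * (p ^+ 6 * (M ^+ 4 * e)) by rewrite eE; ring.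
  move: T_lower' h1 h2; rewrite -mulrA.
  move: (X ^+ 13 * K ^+ 6) (p ^+ 6 * T) (p ^+ 6 * (delta * a ^+ 7)) => u v s.
  move: (p ^+ 6 * (M ^+ 4 * e)) => t; lra.
have -> : a ^+ 11 / K ^+ 7 = X ^+ 11 * K ^+ 4.
  by rewrite aE; field; rewrite gt_eqF.
have M4_ge0 : 0 <= M ^+ 4 by rewrite exprn_even_ge0.
(* The logarithmic factor is at least 1. One factor [p] is bounded below by [X / 2], the other six
   go into [main_term]. *)
apply: le_trans (_ : p ^+ 7 * M ^+ 4 <= _); last first.
  by rewrite ler_peMr ?exprn_ege1 // mulr_ge0 // exprn_ge0.
have -> : 2 ^- 11 * (X ^+ 11 * K ^+ 4) =
    X / 2 * (X ^+ 10 * K ^+ 4 / 2 ^+ 10) by field.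
have -> : p ^+ 7 * M ^+ 4 = p * (p ^+ 6 * M ^+ 4) by ring.
apply: ler_pM => //; first by rewrite divr_ge0 ?ltW.
  by rewrite divr_ge0 ?mulr_ge0 ?exprn_ge0 ?(ltW X_gt0) ?(ltW K_gt0).
by rewrite ler_pdivrMr ?exprn_gt0 // [leRHS]mulrC.
Qed.
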